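(* The solution mapping $S:\mathbb{R}^n\to\mathbb{R}^n$ is directionally differentiable at every point $u\in\mathbb{R}^n$, and for every direction $h\in\mathbb{R}^n$ the directional derivative $\eta=S'(u;h)$ solves the following variational inequality of the first kind: $$\eta\in K(y),\qquad \langle A\eta, v-\eta\rangle\ \ge\ \langle h, v-\eta\rangle\quad\text{for all } v\in K(y),$$ where $y=S(u)$, $q=u-Ay$, and $K(y)$ is the convex cone $$K(y):=\{v\in\mathbb{R}^n:\ v_i=0\ \text{if } |q_i|<1,\ \ v_iq_i\ge 0\ \text{if } y_i=0,\ |q_i|=1\}.$$
   Context: $\langle\cdot,\cdot\rangle$ is the Euclidean scalar product on $\mathbb{R}^n$ and $|v|_1=\sum_{i=1}^n|v_i|$. The matrix $A\in\mathbb{R}^{n\times n}$ is positive definite ($\langle Av,v\rangle>0$ for all $v\ne 0$). For every $u\in\mathbb{R}^n$ the variational inequality of the second kind $$\langle Ay,v-y\rangle+|v|_1-|y|_1\ge\langle u,v-y\rangle\quad\text{for all } v\in\mathbb{R}^n$$ has a unique solution $y\in\mathbb{R}^n$; $S(u):=y$ denotes this solution. The dual (slack) variable is $q:=u-Ay$; it satisfies $q_iy_i=|y_i|$ and $|q_i|\le 1$ for all $i$. Directional differentiability means that $S'(u;h)=\lim_{t\searrow0}\frac{S(u+th)-S(u)}{t}$ exists for every $h$. *)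

(* Defs.v *)
From HB Require Import structures.
From mathcomp Require Import all_boot all_order all_algebra.
From mathcomp Require Import all_classical all_reals all_analysis.
Import Order.TTheory GRing.Theory Num.Theory.
Import numFieldNormedType.Exports.

Set Implicit Arguments.
Unset Strict Implicit.
Unset Printing Implicit Defensive.

Local Open Scope classical_set_scope.
Local Open Scope ring_scope.

(* Vectors of R^n are column vectors; the topology on 'cV[R]_n is the usual
   finite-dimensional one. *)

Definition dotv (R : realType) (n : nat) (v w : 'cV[R]_n) : R :=
  \sum_(i < n) v i 0 * w i 0.

Definition norm1 (R : realType) (n : nat) (v : 'cV[R]_n) : R :=
  \sum_(i < n) `|v i 0|.

(* Symmetry of A is not required. *)
Definition posdef (R : realType) (n : nat) (A : 'M[R]_n) : Prop :=
  forall v : 'cV[R]_n, v != 0 -> 0 < dotv (A *m v) v.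

Definition solves_vi2 (R : realType) (n : nat) (A : 'M[R]_n)
    (u y : 'cV[R]_n) : Prop :=
  forall v : 'cV[R]_n,
    dotv (A *m y) (v - y) + norm1 v - norm1 y >= dotv u (v - y).

(* The default value 0 is irrelevant when A is positive definite: there is
   then exactly one solution for every u. *)
Definition solution_map (R : realType) (n : nat) (A : 'M[R]_n)
    (u : 'cV[R]_n) : 'cV[R]_n :=
  xget 0 [set y | solves_vi2 A u y].

Definition dir_quotient (R : realType) (n : nat) (S : 'cV[R]_n -> 'cV[R]_n)
    (u h : 'cV[R]_n) (t : R) : 'cV[R]_n :=
  t^-1 *: (S (u + t *: h) - S u).

Definition dir_differentiable (R : realType) (n : nat)
    (S : 'cV[R]_n -> 'cV[R]_n) (u : 'cV[R]_n) : Prop :=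
  forall h : 'cV[R]_n, cvg (dir_quotient S u h t @[t --> 0^'+]).

(* Meaningful when the limit exists; 'lim' is total. *)
Definition dir_derivative (R : realType) (n : nat)
    (S : 'cV[R]_n -> 'cV[R]_n) (u h : 'cV[R]_n) : 'cV[R]_n :=
  lim (dir_quotient S u h t @[t --> 0^'+]).

Definition critical_cone (R : realType) (n : nat) (y q : 'cV[R]_n) :
    set 'cV[R]_n :=
  [set v | forall i : 'I_n,
     (`|q i 0| < 1 -> v i 0 = 0) /\
     (y i 0 = 0 -> `|q i 0| = 1 -> 0 <= v i 0 * q i 0)].

Definition solves_vi1 (R : realType) (n : nat) (A : 'M[R]_n)
    (K : set 'cV[R]_n) (h eta : 'cV[R]_n) : Prop :=
  K eta /\
  forall v : 'cV[R]_n, K v -> dotv (A *m eta) (v - eta) >= dotv h (v - eta).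

(* Main.v *)
(* The problem is piecewise linear, so the difference quotients are eventually
   constant. Both variational inequalities separate over the coordinates up to
   the coupling by A; each has a solution, the fixed point of a proximal
   gradient step that contracts the Euclidean norm, A being coercive by
   compactness of the unit sphere. Given the solution eta of the inequality on
   K(y), the vector y + t eta satisfies coordinatewise the optimality conditions
   |q_i| <= 1, q_i y_i = |y_i| for the datum u + t h as soon as t > 0 is small,
   hence S(u + t h) = y + t eta by uniqueness. *)
Require Import Defs.
From HB Require Import structures.
From mathcomp Require Import all_boot all_order all_algebra.
From mathcomp Require Import all_classical all_reals all_analysis.
From mathcomp Require Import ring lra.
Import Order.TTheory GRing.Theory Num.Theory.
Import numFieldNormedType.Exports.
Local Open Scope ring_scope.

(** Gives matrices the complete normed module structure that [banach_fixed_point] requires. *)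
HB.instance Definition _ (R : realType) m n := Complete.on 'M[R]_(m, n).

(** * Coercivity and existence for separable variational inequalities *)

Section Existence.
Local Open Scope classical_set_scope.
Local Open Scope ring_scope.
Context {R : realType} {n : nat}.
Implicit Types (A : 'M[R]_n) (u v w y : 'cV[R]_n).

Lemma le_entry_norm v i : `|v i 0| <= `|v|.
Proof.
rewrite [leRHS]/Num.norm /= mx_normrE; apply/bigmax_geP; right => /=.
by exists (i, 0).
Qed.

(** [|v|] is the max-norm, attained at an entry whose square is a term of the sum. *)
Lemma sqr_norm_le_dotv v : `|v| ^+ 2 <= dotv v v.
Proof.
have [->|v0] := eqVneq `|v| 0.
  by rewrite expr0n /=; apply: sumr_ge0 => i _; rewrite -expr2 sqr_ge0.
have [[i j] vi] := mx_norm_neq0 v0.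
rewrite [X in X ^+ 2]vi /= (ord1 j) real_normK ?num_real //.
rewrite /dotv (bigD1 i) //= -expr2 lerDl.
by apply: sumr_ge0 => k _; rewrite -expr2 sqr_ge0.
Qed.

Lemma dotv_le_sqr_norm v : dotv v v <= n%:R * `|v| ^+ 2.
Proof.
have -> : n%:R * `|v| ^+ 2 = \sum_(i < n) `|v| ^+ 2.
  by rewrite sumr_const card_ord mulr_natl.
apply: ler_sum => i _; rewrite -expr2 -real_normK ?num_real //.
by rewrite lerXn2r ?nnegrE ?normr_ge0 ?le_entry_norm.
Qed.

Lemma dotv_ge0 v : 0 <= dotv v v.
Proof. by apply: le_trans (sqr_norm_le_dotv v); rewrite sqr_ge0. Qed.

Lemma dotvZ (a b : R) v w : dotv (a *: v) (b *: w) = a * b * dotv v w.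
Proof.
by rewrite /dotv mulr_sumr; apply: eq_bigr => i _; rewrite !mxE mulrACA.
Qed.

Lemma dotvBr u v w : dotv u (v - w) = dotv u v - dotv u w.
Proof.
by rewrite /dotv -sumrB; apply: eq_bigr => i _; rewrite !mxE mulrBr.
Qed.

Lemma dotvBl u v w : dotv (v - w) u = dotv v u - dotv w u.
Proof.
by rewrite /dotv -sumrB; apply: eq_bigr => i _; rewrite !mxE mulrBl.
Qed.

Lemma dotvC v w : dotv v w = dotv w v.
Proof. by apply: eq_bigr => i _; rewrite mulrC. Qed.

(** Up to a norm comparison, [a] is the minimum of the form on the compact max-norm unit sphere;
    homogeneity extends the bound to all [v]. Row vectors serve to apply
    [bounded_closed_compact]. *)
Lemma posdef_coercive A : posdef A ->
  exists2 a : R, 0 < a & forall v, a * dotv v v <= dotv (A *m v) v.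
Proof.
move=> hA.
pose f (x : 'rV[R]_n) : R := dotv (A *m x^T) x^T.
pose S := [set x : 'rV[R]_n | `|x| = 1].
have trcont i : continuous (fun x : 'rV[R]_n => x^T i 0).
  have -> : (fun x : 'rV[R]_n => x^T i 0) = (fun x => x 0 i).
    by apply/funext => x; rewrite mxE.
  exact: coord_continuous.
have Acont i : continuous (fun x : 'rV[R]_n => (A *m x^T) i 0).
  have -> : (fun x : 'rV[R]_n => (A *m x^T) i 0) =
      (fun x => \sum_j A i j * x^T j 0) by apply/funext => x; rewrite mxE.
  apply: continuous_big => [|j _ x]; first exact: add_continuous.
  by apply: continuousM; [exact: cst_continuous | exact: trcont].
have fcont : continuous f.
  apply: continuous_big => [|i _ x]; first exact: add_continuous.
  by apply: continuousM; [exact: Acont | exact: trcont].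
have Scompact : compact S.
  apply: bounded_closed_compact.
    by exists 1; split => // M M1 x /= ->; exact: ltW.
  apply: (@closed_comp _ _ (fun x : 'rV[R]_n => `|x|) [set 1]).
    by move=> x _; exact: norm_continuous.
  exact: closed_eq.
(* If the sphere is empty, every vector is zero and any constant works. *)
have [S0|Sempty] := pselect (S !=set0); last first.
  exists 1 => // v; suff -> : v = 0.
    by rewrite mulmx0 /dotv !big1 ?mulr0 // => i _; rewrite mxE mulr0.
  have [//|v0] := eqVneq v 0; case: Sempty.
  have vT0 : v^T != 0 by rewrite -trmx0 (inj_eq trmx_inj).
  exists (`|v^T|^-1 *: v^T) => /=.
  by rewrite /S /= normrZ normfV normr_id mulVf // normr_eq0.
have [c cS cmin] : exists2 c, c \in S & forall x, x \in S -> f c <= f x.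
  by apply: compact_EVT_min => //; exact: continuous_subspaceT.
have fc0 : 0 < f c.
  apply: hA; rewrite -trmx0 (inj_eq trmx_inj) -normr_eq0.
  by move: cS; rewrite inE => /= ->; rewrite oner_neq0.
(* The divisor compares [dotv v v] with the squared max-norm; [n.+1] is positive for every [n]. *)
exists (f c / n.+1%:R); first by rewrite divr_gt0.
move=> v; have [->|v0] := eqVneq v 0.
  by rewrite mulmx0 /dotv !big1 ?mulr0 // => i _; rewrite mxE mulr0.
have vT0 : v^T != 0 by rewrite -trmx0 (inj_eq trmx_inj).
have nv0 : 0 < `|v^T| by rewrite normr_gt0.
have := cmin (`|v^T|^-1 *: v^T); rewrite inE /S /= normrZ normfV normr_id.
rewrite mulVf ?gt_eqF // => /(_ erefl).
rewrite /f linearZ /= trmxK -scalemxAr dotvZ -expr2 -/(f c) => le1.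
have le2 : dotv v v <= n.+1%:R * `|v^T| ^+ 2.
  have -> : dotv v v = \sum_i v^T 0 i ^+ 2.
    by apply: eq_bigr => i _; rewrite mxE expr2.
  apply: (@le_trans _ _ (n%:R * `|v^T| ^+ 2)); last first.
    by rewrite ler_wpM2r ?sqr_ge0 // ler_nat.
  have -> : n%:R * `|v^T| ^+ 2 = \sum_(i < n) `|v^T| ^+ 2.
    by rewrite sumr_const card_ord mulr_natl.
  apply: ler_sum => i _; rewrite -real_normK ?num_real //.
  rewrite lerXn2r ?nnegrE ?normr_ge0 // [leRHS]/Num.norm /= mx_normrE.
  by apply/bigmax_geP; right; exists (0, i).
move: le1; rewrite exprVn mulrC ler_pdivlMr ?exprn_gt0 // => le1.
apply: le_trans le1.
rewrite -mulrA ler_wpM2l ?(ltW fc0) // ler_pdivrMl ?ltr0n //.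
Qed.

Lemma mulmx_dotv_bounded A :
  exists2 C : R, 0 < C & forall v, dotv (A *m v) (A *m v) <= C * dotv v v.
Proof.
pose M : R := \sum_i \sum_j `|A i j|.
have M0 : 0 <= M by do 2 (apply: sumr_ge0 => ? _).
(* The [+ 1] keeps the constant positive even if [A] vanishes. *)
exists (n%:R * M ^+ 2 + 1) => [|v].
  by rewrite ltr_wpDl // mulr_ge0 // sqr_ge0.
have entry i : `|(A *m v) i 0| <= M * `|v|.
  rewrite mxE; apply: le_trans (ler_norm_sum _ _ _) _.
  apply: (@le_trans _ _ (\sum_j `|A i j| * `|v|)).
    by apply: ler_sum => j _; rewrite normrM ler_wpM2l // le_entry_norm.
  rewrite -mulr_suml ler_wpM2r // /M [leRHS](bigD1 i) //= lerDl.
  by apply: sumr_ge0 => k _; apply: sumr_ge0.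
apply: (@le_trans _ _ (n%:R * M ^+ 2 * dotv v v)); last first.
  by rewrite ler_wpM2r ?dotv_ge0 // lerDl.
apply: (@le_trans _ _ (n%:R * M ^+ 2 * `|v| ^+ 2)); last first.
  by rewrite ler_wpM2l ?sqr_norm_le_dotv // mulr_ge0 // sqr_ge0.
have -> : n%:R * M ^+ 2 * `|v| ^+ 2 = \sum_(i < n) (M * `|v|) ^+ 2.
  by rewrite sumr_const card_ord -[RHS]mulr_natl -mulrA exprMn.
apply: ler_sum => i _; rewrite -expr2 -real_normK ?num_real //.
by rewrite lerXn2r ?nnegrE ?mulr_ge0.
Qed.

(* Some iterate of [T] is a contraction for the max-norm carried by ['cV_n]. *)
Lemma euclidean_contraction_fixpoint (T : 'cV[R]_n -> 'cV[R]_n) (c : R) :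
  0 <= c < 1 ->
  (forall v w, dotv (T v - T w) (T v - T w) <= c * dotv (v - w) (v - w)) ->
  exists y, T y = y.
Proof.
move=> /andP[c0 c1] Tc.
have iterc k v w : dotv (iter k T v - iter k T w) (iter k T v - iter k T w) <=
    c ^+ k * dotv (v - w) (v - w).
  elim: k => [|k IH] /=; first by rewrite expr0 mul1r.
  by apply: le_trans (Tc _ _) _; rewrite exprS -mulrA ler_wpM2l.
(* [c ^+ k * n] bounds the squared Lipschitz constant of [iter k T] in the max-norm; the bound 1/4
   makes 1/2 a contraction factor. *)
have [k ck] : exists k, c ^+ k * n.+1%:R <= 2^-1 ^+ 2.
  have e0 : 0 < 2^-1 ^+ 2 / n.+1%:R :> R by rewrite divr_gt0 ?exprn_gt0.
  have : ((fun k => c ^+ k) @ \oo --> (0 : R)).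
    by apply: cvg_expr; rewrite ger0_norm.
  move=> /cvgrPdist_lt /(_ _ e0) [k _ /(_ k (leqnn k))] /=.
  rewrite sub0r normrN ger0_norm ?exprn_ge0 // => /ltW.
  by rewrite ler_pdivlMr // => ?; exists k.
have contr : is_contraction (totalfun (iter k T) :
    {fun [set: 'cV[R]_n] >-> [set: 'cV[R]_n]}).
  exists (2^-1)%:nng; split => /=; first by rewrite invf_lt1 // ltr1n.
  move=> [v w] _ /=.
  rewrite -(@ler_pXn2r _ 2) ?nnegrE ?mulr_ge0 //.
  apply: le_trans (sqr_norm_le_dotv _) _; apply: le_trans (iterc _ _ _) _.
  apply: le_trans (ler_wpM2l (exprn_ge0 _ c0) (dotv_le_sqr_norm _)) _.
  rewrite mulrA exprMn ler_wpM2r ?sqr_ge0 //; apply: le_trans ck.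
  by rewrite ler_wpM2l ?exprn_ge0 // ler_nat.
have [y _ yE] := banach_fixed_point contr closedT (ex_intro _ 0 I).
(* [T y] is a fixed point of [iter k T] too, so it equals [y] by uniqueness. *)
exists y; apply: contraction_fixpoint_unique contr _ _ _ _ => //.
by change (T y = iter k T (T y)); rewrite -iterSr iterS; congr T.
Qed.

(* The hypothesis on [p] says that [p = argmin_D (rho * phi + |. - z|^2 / 2)]:
   the solution is the fixed point of the projected gradient step
   [y |-> prox (y - rho * (A y - u))] for small [rho]. *)
Lemma separable_vi_exists A u (D : 'I_n -> set R) (phi : 'I_n -> R -> R) :
  posdef A ->
  (forall i (rho z : R), 0 < rho -> exists p, D i p /\
     forall s, D i s -> (z - p) * (s - p) <= rho * (phi i s - phi i p)) ->
  exists y, forall i, D i (y i 0) /\ forall s, D i s ->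
    (u - A *m y) i 0 * (s - y i 0) <= phi i s - phi i (y i 0).
Proof.
move=> hA hprox.
have [a a0 Aa] := posdef_coercive _ hA.
have [C C0 AC] := mulmx_dotv_bounded A.
(* This choice gives [rho ^+ 2 * C = rho * a - (rho * a) ^+ 2], so the squared factor
   [1 - 2 * rho * a + rho ^+ 2 * C] is at most [1 - rho * a]; the term [a ^+ 2] ensures
   [rho * a <= 1]. *)
pose rho := a / (C + a ^+ 2).
have Ca0 : 0 < C + a ^+ 2 by rewrite ltr_wpDr // sqr_ge0.
have rho0 : 0 < rho by rewrite divr_gt0.
pose isprox i z p := D i p /\
  forall s, D i s -> (z - p) * (s - p) <= rho * (phi i s - phi i p).
pose P i z := xget 0 [set p | isprox i z p].
have PP i z : isprox i z (P i z).
  by apply: (@xgetPex _ 0 [set p | isprox i z p]); exact: hprox.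
(* Testing each proximal inequality with the other point and adding cancels [phi]:
   [(P z - P z')^2 <= (z - z') (P z - P z')]. *)
have Pnonexp i z z' : (P i z - P i z') ^+ 2 <= (z - z') ^+ 2.
  have [Dz /(_ (P i z')) h1] := PP i z; have [Dz' /(_ (P i z)) h2] := PP i z'.
  have := sqr_ge0 ((z - z') - (P i z - P i z')).
  by move: (h1 Dz') (h2 Dz) => {h1 h2}; nra.
pose g y := y - rho *: (A *m y - u).
pose T y := \col_i P i (g y i 0) : 'cV[R]_n.
pose c := 1 - rho * a.
have rhoE : rho * (C + a ^+ 2) = a by rewrite /rho divfK // gt_eqF.
have c1 : c < 1 by rewrite /c ltrBlDr ltrDl mulr_gt0.
have c0 : 0 <= c.
  rewrite /c subr_ge0 -(ler_pM2r Ca0) mul1r mulrAC rhoE -expr2.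
  by rewrite lerDr ltW.
have Tc v w : dotv (T v - T w) (T v - T w) <= c * dotv (v - w) (v - w).
  apply: (@le_trans _ _ (dotv (g v - g w) (g v - g w))).
    by apply: ler_sum => i _; rewrite !mxE -!expr2; exact: Pnonexp.
  have -> : g v - g w = (v - w) - rho *: (A *m (v - w)).
    by rewrite /g mulmxBr !scalerBr; apply/colP => i; rewrite !mxE; ring.
  move: (v - w) => d.
  have := Aa d; have := AC d.
  rewrite dotvBl !dotvBr dotvZ.
  have -> : dotv (rho *: (A *m d)) d = rho * dotv (A *m d) d.
    by rewrite -[in LHS](scale1r d) -scalemxAr dotvZ mulr1 scale1r.
  have -> : dotv d (rho *: (A *m d)) = rho * dotv (A *m d) d.
    by rewrite dotvC -[d in dotv _ d]scale1r dotvZ mulr1.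
  move=> h1 h2; have := ler_wpM2l (ltW rho0) h2.
  have := ler_wpM2l (sqr_ge0 rho) h1.
  have : 0 <= rho ^+ 2 * a ^+ 2 * dotv d d.
    by rewrite mulr_ge0 ?dotv_ge0 // mulr_ge0 ?sqr_ge0.
  have : rho ^+ 2 * (C * dotv d d) =
      rho * a * dotv d d - rho ^+ 2 * a ^+ 2 * dotv d d.
    by rewrite -[X in rho * X * _]rhoE; ring.
  rewrite /c; nra.
have [y yE] := euclidean_contraction_fixpoint _ _ (introT andP (conj c0 c1)) Tc.
exists y => i; have yi : y i 0 = P i (g y i 0) by rewrite -[in LHS]yE mxE.
(* At the fixed point [z - p] is [rho] times the residual [u - A *m y]; dividing by [rho]
   concludes. *)
have := PP i (g y i 0); rewrite /isprox -yi => -[Dy hy]; split => // s /hy.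
rewrite -[_ <= phi _ _ - _](ler_pM2l rho0) mulrA; congr (_ * _ <= _).
by rewrite /g !mxE; ring.
Qed.

End Existence.

(** * Subgradients of the absolute value and their perturbation *)

Section AbsSubdifferential.
Local Open Scope classical_set_scope.
Local Open Scope ring_scope.
Context {R : realType}.
Implicit Types q y z r e : R.

(** The tests [s = 0] and [s = 2 * y] force [q * y = |y|]; [s = y + q] gives [q^2 <= |q|] by the
    triangle inequality. Conversely [q * s <= |s|]. *)
Lemma abs_subgradP q y :
  (forall s, q * (s - y) <= `|s| - `|y|) <-> `|q| <= 1 /\ q * y = `|y|.
Proof.
split=> [h|[q1 qy] s].
  have h0 := h 0; have h2 := h (2 * y); have hq := h (y + q).
  have := ler_normD y q; rewrite normr0 normrM ger0_norm // in h0 h2 *.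
  have q2 : q * q = `|q| * `|q| by rewrite -!expr2 real_normK ?num_real.
  move=> hD; split; first by have := normr_ge0 q; nra.
  by apply/eqP; rewrite eq_le; apply/andP; split; lra.
have : q * s <= `|s|.
  by apply: le_trans (ler_norm _) _; rewrite normrM ler_piMl.
lra.
Qed.

(** Soft thresholding: [p] is [z - rho], [z + rho] or 0, which makes [(z - p) / rho] a subgradient
    at [p]. *)
Lemma abs_prox_exists (rho z : R) : 0 < rho ->
  exists p : R, forall s, (z - p) * (s - p) <= rho * (`|s| - `|p|).
Proof.
move=> rho0.
have subgrad p : `|(z - p) / rho| <= 1 -> (z - p) / rho * p = `|p| ->
    forall s, (z - p) * (s - p) <= rho * (`|s| - `|p|).
  move=> h1 h2 s; have /abs_subgradP /(_ s) := conj h1 h2.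
  by rewrite -(ler_pM2l rho0) mulrA mulrCA divff ?gt_eqF // mulr1.
have [zr|rz] := ltP rho z.
  exists (z - rho); apply: subgrad; rewrite opprB addrCA subrr addr0 divff ?gt_eqF //.
    by rewrite normr1.
  by rewrite mul1r gtr0_norm // subr_gt0.
have [zr|zr] := ltP z (- rho).
  exists (z + rho); apply: subgrad; rewrite opprD addrA subrr add0r mulNr divff ?gt_eqF //.
    by rewrite normrN1.
  by rewrite mulN1r ltr0_norm //; lra.
exists 0; apply: subgrad; rewrite subr0 ?mulr0 ?normr0 //.
by rewrite normf_div (gtr0_norm rho0) ler_pdivrMr // mul1r ler_norml zr.
Qed.

(** [critical_cone] is the product of these sets, each of them [{0}], a half-line or the whole
    line. *)
Definition cone1 y q : set R :=
  [set s | (`|q| < 1 -> s = 0) /\ (y = 0 -> `|q| = 1 -> 0 <= s * q)].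

(** [p] is the projection of [z] onto the cone, found separately for the three shapes. *)
Lemma cone1_prox_exists y q z :
  exists2 p, cone1 y q p & forall s, cone1 y q s -> (z - p) * (s - p) <= 0.
Proof.
have [q1|q1] := ltP `|q| 1.
  exists 0; first by split=> // _ _; rewrite mul0r.
  by move=> s [/(_ q1) -> _]; rewrite !subrr mulr0.
have [[y0 q1']|ny] := pselect (y = 0 /\ `|q| = 1); last first.
  exists z; last by move=> s _; rewrite subrr mul0r.
  by split=> [|y0 q1']; [rewrite ltNge q1 | case: ny].
have qq : q * q = 1 by rewrite -expr2 -real_normK ?num_real // q1' expr1n.
have zE : z * q * q = z by rewrite -mulrA qq mulr1.
have [zq|zq] := leP 0 (z * q).
  by exists z => [|s _]; [split=> // /lt_eqF; rewrite q1' eqxx | rewrite subrr mul0r].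
exists 0; first by split=> // _ _; rewrite mul0r.
move=> s [_ /(_ y0 q1') sq]; rewrite !subr0.
have -> : z * s = (z * q) * (s * q) by rewrite mulrACA qq mulr1.
by rewrite mulr_le0_ge0 // ltW.
Qed.

(* Since [|.|] is piecewise linear, the inclusion [q \in d|.|(y)] persists
   exactly, and not just to first order, along [(e, r)] when [r] lies in the
   normal cone at [e] to the critical cone. *)
Lemma abs_subgrad_near q y e r :
  `|q| <= 1 -> q * y = `|y| -> cone1 y q e ->
  (forall s, cone1 y q s -> r * (s - e) <= 0) ->
  \forall t \near (0 : R)^'+,
    `|q + t * r| <= 1 /\ (q + t * r) * (y + t * e) = `|y + t * e|.
Proof.
move=> q1 qy [e0 eq0] he.
have small (a b : R) : 0 < a -> \forall t \near (0 : R)^'+, 0 < t /\ t * `|b| < a.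
  move=> a0; near=> t; split; first by near: t; exact: nbhs_right_gt.
  have b1 : 0 < `|b| + 1 by rewrite ltr_wpDl.
  have t0 : 0 < t by near: t; exact: nbhs_right_gt.
  apply: (@lt_trans _ _ (t * (`|b| + 1))); first by rewrite ltr_pM2l // ltrDl.
  rewrite -ltr_pdivlMr //; near: t; apply: nbhs_right_lt; exact: divr_gt0.
(* If [|q| < 1], then [|y| <= |q| |y|] forces [y = 0], the cone forces [e = 0], and only
   [|q + t * r| <= 1] remains. *)
have [ql|qg] := ltP `|q| 1.
  have y0 : y = 0.
    apply/eqP; rewrite -normr_eq0 -qy; apply/eqP; move: (ler_norm (q * y)).
    rewrite normrM; move: (normr_ge0 y) => y0; nra.
  have e00 := e0 ql.
  have : \forall t \near (0 : R)^'+, 0 < t /\ t * `|r| < 1 - `|q|.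
    by apply: small; rewrite subr_gt0.
  apply: filterS => t [t0 tr]; rewrite y0 e00 mulr0 addr0 mulr0 normr0; split=> //.
  by apply: le_trans (ler_normD _ _) _; rewrite normrM (gtr0_norm t0); lra.
have q1' : `|q| = 1 by apply/eqP; rewrite eq_le q1 qg.
have qq : q * q = 1 by rewrite -expr2 -real_normK ?num_real // q1' expr1n.
(* If [y] is nonzero, the cone is the whole line, so [r = 0], and [y + t * e] keeps the sign of
   [y]. *)
have [y0|yn0] := eqVneq y 0; last first.
  have r0 : r = 0.
    have inC s : cone1 y q s by split=> [|/eqP]; [rewrite q1' ltxx | rewrite (negbTE yn0)].
    have := he (e + r) (inC _); rewrite addrAC subrr add0r.
    by move=> h; apply/eqP; rewrite -sqrf_eq0 eq_le sqr_ge0 expr2 h.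
  have : \forall t \near (0 : R)^'+, 0 < t /\ t * `|e| < `|y|.
    by apply: small; rewrite normr_gt0.
  apply: filterS => t [t0 te]; rewrite r0 mulr0 addr0; split=> //.
  have : `|q * (t * e)| < `|y| by rewrite !normrM q1' mul1r (gtr0_norm t0).
  rewrite ltr_norml => /andP[h1 h2].
  have -> : `|y + t * e| = `|q * (y + t * e)| by rewrite normrM q1' mul1r.
  by rewrite ger0_norm // mulrDr; lra.
have e_ge0 := eq0 y0 q1'.
have C0 : cone1 y q 0 by split=> // _ _; rewrite mul0r.
have Ceq a : 0 <= a * q -> cone1 y q a by move=> aq; split=> //; rewrite q1' ltxx.
(* On the half-line, the tests 0 and [2 * e] give [r * e = 0], and [e + q] gives [r * q <= 0]. *)
have re : r * e = 0.
  have := he _ C0; have := he (2 * e) (Ceq _ _); rewrite -mulrA => /(_ (mulr_ge0 _ e_ge0)).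
  by move=> /(_ (ler0n _ _)); lra.
have rq : r * q <= 0.
  have := he (e + q) (Ceq _ _); rewrite mulrDl qq addrAC subrr add0r; apply.
  by rewrite addr_ge0.
have : \forall t \near (0 : R)^'+, 0 < t /\ t * `|r| < 1 by exact: small.
(* Multiplication by [q], of modulus 1, keeps absolute values and turns [q + t * r] into
   [1 + t * (r * q)], which lies in [[0, 1]]. *)
apply: filterS => t [t0 tr]; split.
  have -> : `|q + t * r| = `|1 + t * (r * q)|.
    have -> : 1 + t * (r * q) = (q + t * r) * q by rewrite mulrDl qq mulrA.
    by rewrite normrM q1' mulr1.
  have : `|t * (r * q)| < 1 by rewrite !normrM q1' mulr1 (gtr0_norm t0).
  rewrite ltr_norml => /andP[h _]; have := mulr_ge0_le0 (ltW t0) rq => h'.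
  by rewrite ger0_norm; lra.
rewrite y0 add0r mulrDl mulrACA re mulr0 addr0.
have -> : `|t * e| = `|t * (e * q)| by rewrite !normrM q1' mulr1.
rewrite ger0_norm; last by rewrite mulr_ge0 // ltW.
by rewrite mulrCA (mulrC q).
Unshelve. all: by end_near. Qed.
End AbsSubdifferential.

(** * The solution map and its difference quotients *)

Section SolutionMap.
Local Open Scope classical_set_scope.
Local Open Scope ring_scope.
Context {R : realType} {n : nat} (A : 'M[R]_n) (hA : posdef A).
Implicit Types u y h eta : 'cV[R]_n.

(** Testing each inequality with the other solution and adding makes the form nonpositive at
    [y - y']. *)
Lemma solves_vi2_unique u y y' : solves_vi2 A u y -> solves_vi2 A u y' -> y = y'.
Proof.
move=> hy hy'; apply/eqP; rewrite -subr_eq0; apply: contraT => /hA.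
have := hy y'; have := hy' y.
rewrite mulmxBr dotvBl !dotvBr; lra.
Qed.

Lemma abs_subgrad_solves_vi2 u y :
  (forall i, let q := u - A *m y in `|q i 0| <= 1 /\ q i 0 * y i 0 = `|y i 0|) ->
  solves_vi2 A u y.
Proof.
move=> hq v; rewrite /norm1 /dotv -subr_ge0 -!big_split /= -!sumrB.
apply: sumr_ge0 => i _.
have /abs_subgradP /(_ (v i 0)) := hq i; rewrite !mxE; lra.
Qed.

Lemma solution_map_eq u y :
  (forall i, let q := u - A *m y in `|q i 0| <= 1 /\ q i 0 * y i 0 = `|y i 0|) ->
  solution_map A u = y.
Proof.
move=> /abs_subgrad_solves_vi2 hy; apply: xget_unique => // y' hy'.
exact: solves_vi2_unique hy' hy.
Qed.

(** The existence result with [phi] the absolute value yields a point with these properties, and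
    [solution_map_eq] identifies it. *)
Lemma solution_map_subgrad u i :
  let y := solution_map A u in let q := u - A *m y in
  `|q i 0| <= 1 /\ q i 0 * y i 0 = `|y i 0|.
Proof.
have [y hy] := separable_vi_exists A u (fun=> setT) (fun=> Num.norm) hA
  (fun _ rho z rho0 => let: ex_intro p hp := abs_prox_exists rho z rho0 in
     ex_intro _ p (conj I (fun s _ => hp s))).
have yq j : let q := u - A *m y in `|q j 0| <= 1 /\ q j 0 * y j 0 = `|y j 0|.
  by apply/abs_subgradP => s; have [_ /(_ s I)] := hy j.
by rewrite (solution_map_eq u y yq); exact: yq.
Qed.

Lemma dir_quotient_solution_map_near u h :
  let y := solution_map A u in
  exists2 eta, solves_vi1 A (critical_cone y (u - A *m y)) h eta &
    \forall t \near (0 : R)^'+, dir_quotient (solution_map A) u h t = eta.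
Proof.
move=> y; set q := u - A *m y.
(* The constraint is carried by the sets [cone1] alone, so [phi] is zero. *)
have [|eta heta] := separable_vi_exists A h
    (fun i => cone1 (y i 0) (q i 0)) (fun _ _ => 0) hA.
  move=> i rho z _; have [p Cp hp] := cone1_prox_exists (y i 0) (q i 0) z.
  by exists p; split=> // s /hp; rewrite subrr mulr0.
exists eta.
  split=> [i|v Cv]; first by have [] := heta i.
  rewrite -subr_le0 -dotvBl; apply: sumr_le0 => i _.
  have [_ /(_ (v i 0) (Cv i))] := heta i.
  by rewrite subrr !mxE.
(* [q + t *: (h - A *m eta)] is the dual variable of [y + t *: eta]. Coordinatewise [h - A *m eta]
   is normal to the cone at [eta], and finitely many coordinates admit a common range of [t]. *)
have near_subgrad : \forall t \near (0 : R)^'+, forall i,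
    `|q i 0 + t * (h - A *m eta) i 0| <= 1 /\
    (q i 0 + t * (h - A *m eta) i 0) * (y i 0 + t * eta i 0) =
      `|y i 0 + t * eta i 0|.
  apply: filter_forall => i; have [qi qyi] := solution_map_subgrad u i.
  have [Ceta leta] := heta i; apply: abs_subgrad_near => // s /leta.
  by rewrite subrr.
have : \forall t \near (0 : R)^'+, 0 < t by exact: nbhs_right_gt.
move: near_subgrad; apply: filterS2 => t hq t0.
rewrite /dir_quotient (solution_map_eq _ (y + t *: eta)).
  by rewrite addrC addKr scalerA mulVf ?scale1r // gt_eqF.
move=> i; have -> : u + t *: h - A *m (y + t *: eta) = q + t *: (h - A *m eta).
  by rewrite mulmxDr -scalemxAr /q; apply/colP => j; rewrite !mxE; ring.
by have := hq i; clearbody q; move: (h - A *m eta) => r; rewrite /= !mxE.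
Qed.

End SolutionMap.

Theorem theorem2p7 (R : realType) (n : nat) (A : 'M[R]_n) (hA : posdef A) :
  (forall u : 'cV[R]_n, dir_differentiable (solution_map A) u) /\
  (forall u h : 'cV[R]_n,
     let y := solution_map A u in
     let q := u - A *m y in
     solves_vi1 A (critical_cone y q) h
       (dir_derivative (solution_map A) u h)).
Proof.
split=> [u h|u h y q].
  have [eta _ near_eta] := dir_quotient_solution_map_near A hA u h.
  exact: is_cvg_near_cst near_eta.
have [eta eta_vi1 near_eta] := dir_quotient_solution_map_near A hA u h.
by rewrite /dir_derivative (lim_near_cst _ near_eta).
Qed.
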